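(* Let $\mathcal S$ be a separable metric space equipped with a reference measure, integration against which is written $ds$. Let $t_{\mathfrak s}:\mathcal S\times\mathcal S\to\mathbb R^{\ge0}$ be a transition density ($\int_{\mathcal S}t_{\mathfrak s}(\bar s|s)\,d\bar s=1$ for all $s$), $\pi_0$ a probability density on $\mathcal S$, and $\pi_{t+1}(\bar s)=\int_{\mathcal S}t_{\mathfrak s}(\bar s|s)\pi_t(s)\,ds$. Assume $M_{\mathfrak f}:=\sup_{\bar s\in\mathcal S}\int_{\mathcal S}t_{\mathfrak s}(\bar s|s)\,ds<\infty$. Suppose there are sets $\varGamma\subset\mathcal S^2$, $\Lambda_0\subset\mathcal S$ and positive constants $\epsilon,\varepsilon_0$ with $t_{\mathfrak s}(\bar s|s)\le\epsilon$ for all $(s,\bar s)\in\mathcal S^2\setminus\varGamma$ and $\pi_0(s)\le\varepsilon_0$ for all $s\in\mathcal S\setminus\Lambda_0$. Define recursively $\varepsilon_{t+1}=\epsilon+M_{\mathfrak f}\varepsilon_t$ and $\Lambda_{t+1}=\{\bar s\in\mathcal S:\exists s\in\Lambda_t,\ (s,\bar s)\in\varGamma\}$. Fix $N\in\mathbb N$, let $\Upsilon=\bigcup_{t=0}^N\Lambda_t$, and define functions $\mu_t:\mathcal S\to\mathbb R^{\ge0}$ by $\mu_0(s)=\mathds 1_{\Lambda_0}(s)\pi_0(s)$ and $\mu_{t+1}(\bar s)=\mathds 1_{\Upsilon}(\bar s)\int_{\mathcal S}t_{\mathfrak s}(\bar s|s)\mu_t(s)\,ds$ for all $\bar s\in\mathcal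 S$. Then $\sup_{s\in\mathcal S}|\pi_t(s)-\mu_t(s)|\le\varepsilon_t$ for all $t\in\{0,1,\dots,N\}$.
   Context: $\mathds 1_A$ denotes the indicator function of a set $A$. Pairs in $\varGamma$ are written $(s,\bar s)$ with $s$ the current and $\bar s$ the next state. *)

(* Defs.v *)
From HB Require Import structures.
From mathcomp Require Import all_boot all_order all_algebra.
From mathcomp Require Import all_classical all_reals all_analysis.

Set Implicit Arguments.
Unset Strict Implicit.
Unset Printing Implicit Defensive.

Import Order.TTheory GRing.Theory Num.Theory.
Import numFieldNormedType.Exports.

Local Open Scope classical_set_scope.
Local Open Scope ring_scope.

(* [metricType] is not pointed, while measurable types are; a space that
   carries a probability density is nonempty anyway. *)
#[short(type="pmetricType")]
HB.structure Definition PointedMetric (R : numDomainType) :=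
  {S of Pointed S & Metric R S}.

Definition separable (S : topologicalType) :=
  exists2 D : set S, countable D & dense D.

Notation borel S := (g_sigma_algebraType (@open S)).

Section markov_process.
Context {R : realType} {S : pmetricType R}.
Variable mu : {measure set (borel S) -> \bar R}.

(* In all that follows, [t s' s] is the density at the next state s' given the
   current state s. For separable S the product of the Borel sigma-algebras is
   the Borel sigma-algebra of S * S. *)
Definition transition_density (t : S -> S -> R) :=
  [/\ forall s' s, 0 <= t s' s,
      measurable_fun [set: borel S * borel S] (fun p => t p.1 p.2) &
      forall s, (\int[mu]_s' (t s' s)%:E = 1)%E].

Definition probability_density (p : S -> R) :=
  [/\ forall s, 0 <= p s,
      measurable_fun [set: borel S] p &
      (\int[mu]_s (p s)%:E = 1)%E].

Definition Mf (t : S -> S -> R) : \bar R :=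
  ereal_sup [set (\int[mu]_s (t s' s)%:E)%E | s' in [set: S]].

(* The integrals in [density_at] and [truncated_at] are real-valued: where the
   Lebesgue integral is +oo, the value is 0. *)
Fixpoint density_at (t : S -> S -> R) (p0 : S -> R) (n : nat) : S -> R :=
  if n is m.+1 then fun s' => \int[mu]_s (t s' s * density_at t p0 m s)
  else p0.

Fixpoint error_bound (t : S -> S -> R) (eps eps0 : R) (n : nat) : R :=
  if n is m.+1 then eps + fine (Mf t) * error_bound t eps eps0 m else eps0.

Fixpoint support_at (Gam : set (S * S)) (L0 : set S) (n : nat) : set S :=
  if n is m.+1 then [set s' | exists2 s, support_at Gam L0 m s & Gam (s, s')]
  else L0.

Definition support_upto (Gam : set (S * S)) (L0 : set S) (N : nat) : set S :=
  \bigcup_(n in [set n | (n <= N)%N]) support_at Gam L0 n.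

(* [Gam] and [L0] are arbitrary sets, and the projections in [support_at] need
   not preserve measurability; the library integral of a nonnegative function
   is total, being the supremum over the nonnegative simple functions below
   it (the usual integral when the function is measurable). *)
Fixpoint truncated_at (t : S -> S -> R) (p0 : S -> R) (Gam : set (S * S))
    (L0 : set S) (N n : nat) : S -> R :=
  if n is m.+1 then fun s' =>
    \1_(support_upto Gam L0 N) s' *
    \int[mu]_s (t s' s * truncated_at t p0 Gam L0 N m s)
  else fun s => \1_L0 s * p0 s.

End markov_process.

(* Main.v *)
(* Off Lambda_(n+1) the integrand t pi_n is at most eps pi_n on Lambda_n and at
   most err_n t elsewhere, whence pi_(n+1) <= eps + M err_n as long as pi_n has mass
   at most 1; on Upsilon, the bound pi_n <= mu_n + err_n is propagated with
   factor M. The measure mu is not assumed sigma-finite, and pi_n need not have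
   mass at most 1, but its mass on every sigma-finite set is at most 1, and that
   suffices because {s | t(s'|s) > 0} is sigma-finite when M is finite. *)
From HB Require Import structures.
Require Import Defs.
From mathcomp Require Import all_boot all_order all_algebra.
From mathcomp Require Import all_classical all_reals all_analysis.
From mathcomp Require Import measurable_realfun.

Import Order.TTheory GRing.Theory Num.Theory.
Import numFieldNormedType.Exports.

Local Open Scope classical_set_scope.
Local Open Scope ring_scope.

(** * Sigma-finite sets of an arbitrary measure: exhaustion and Tonelli's theorem *)

Section sigma_finite_sets.
Context {d : measure_display} {T : measurableType d} {R : realType}.
Variable mu : {measure set T -> \bar R}.
Implicit Types (C D : set T) (f : T -> \bar R) (h : T -> R).

Lemma sigma_finite_measurable D : sigma_finite D mu -> measurable D.
Proof. by move=> [F -> mF]; apply: bigcup_measurable => i _; have [] := mF i. Qed.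

Lemma sigma_finite_sub C D :
  sigma_finite D mu -> measurable C -> C `<=` D -> sigma_finite C mu.
Proof.
move=> [F DF mF] mC CD; exists (fun i => F i `&` C).
  by rewrite -setI_bigcupl -DF setIidr.
move=> i; have [mFi Fi] := mF i; have mI := measurableI _ _ mFi mC.
split => //; apply: le_lt_trans Fi.
by apply: le_measure; rewrite ?inE//; exact: subIsetl.
Qed.

Lemma sigma_finite_bigcup (D : nat -> set T) :
  (forall i, sigma_finite (D i) mu) -> sigma_finite (\bigcup_i D i) mu.
Proof.
move=> sD.
have /choice[F FP] : forall i, exists F : nat -> set T,
    D i = \bigcup_j F j /\ forall j, measurable (F j) /\ (mu (F j) < +oo)%E.
  by move=> i; have [F ? ?] := sD i; exists F.
exists (fun n => if unpickle n is Some ij then F ij.1 ij.2 else set0).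
  apply/seteqP; split => [x [i _]|x [n _]].
    rewrite (FP i).1 => -[j _ Fx]; exists (pickle (i, j)) => //.
    by rewrite pickleK.
  case: unpickle => [[i j] /= Fx|//]; exists i => //.
  by rewrite (FP i).1; exists j.
move=> n; case: unpickle => [[i j]|]; first exact: (FP i).2.
by rewrite measure0.
Qed.

Lemma sigma_finiteU C D :
  sigma_finite C mu -> sigma_finite D mu -> sigma_finite (C `|` D) mu.
Proof.
move=> sC sD; rewrite -(bigcup2E C D); apply: sigma_finite_bigcup => -[|[|i]] //=.
by exists (fun=> set0); rewrite ?bigcup_const// => ?; rewrite measure0.
Qed.

(** By Markov's inequality each superlevel set [h >= 1/(i+1)] has finite measure, and these sets
    exhaust the positivity set. *)
Lemma sigma_finite_support h : (forall x, 0 <= h x) ->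
  measurable_fun [set: T] h -> (\int[mu]_x (h x)%:E < +oo)%E ->
  sigma_finite [set x | 0 < h x] mu.
Proof.
move=> h0 mh hoo; exists (fun i => [set x | i.+1%:R^-1 <= h x]).
  apply/seteqP; split => [x /= hx|x [i _] /=]; last first.
    by apply: lt_le_trans; rewrite invr_gt0.
  have [n nx] := ltr_add_invr hx.
  by exists n => //=; move: nx; rewrite add0r => /ltW.
move=> i; set F := [set x | _]; have mF : measurable F.
  rewrite -[F]setTI.
  have -> : F = h @^-1` `[i.+1%:R^-1, +oo[.
    by apply/seteqP; split => x /=; rewrite in_itv/= andbT.
  by apply: (mh measurableT); exact: measurable_itv.
split=> //; have i0 : (0 < i.+1%:R^-1 :> R) by rewrite invr_gt0.
suff : ((i.+1%:R^-1)%:E * mu F < +oo)%E.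
  by case: (mu F) (measure_ge0 mu F) => [r| |] //;
    rewrite ?ltry// gt0_muley ?lte_fin.
apply: le_lt_trans hoo; rewrite -integral_cst//.
apply: (@le_trans _ _ (\int[mu]_(x in F) (h x)%:E)%E).
  apply: ge0_le_integral => //=.
  by apply: measurable_funTS; apply/measurable_EFinP.
apply: ge0_subset_integral => //; first exact/measurable_EFinP.
by move=> x _; rewrite lee_fin.
Qed.

(* The supremum of the integrals over sigma-finite sets is attained. *)
Lemma sigma_finite_exhaustion f (c : R) : (forall x, 0 <= f x)%E ->
  measurable_fun [set: T] f ->
  (forall D, sigma_finite D mu -> (\int[mu]_(x in D) f x <= c%:E)%E) ->
  exists2 C, sigma_finite C mu &
    forall D, sigma_finite D mu -> D `&` C = set0 -> (\int[mu]_(x in D) f x = 0)%E.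
Proof.
move=> f0 mf fc.
pose I := [set (\int[mu]_(x in D) f x)%E | D in [set D | sigma_finite D mu]].
have I0 : I !=set0.
  exists (\int[mu]_(x in set0) f x)%E, set0 => //=.
  by exists (fun=> set0); rewrite ?bigcup_const// => ?; rewrite measure0.
have [u Iu ucvg] := ereal_sup_seq (proj2 (set0P _) I0).
have /choice[D DP] : forall i, exists D, sigma_finite D mu /\
    (\int[mu]_(x in D) f x)%E = u i.
  by move=> i; have [D ? ?] := Iu i; exists D.
have sC : sigma_finite (\bigcup_i D i) mu.
  by apply: sigma_finite_bigcup => i; exact: (DP i).1.
have mC := sigma_finite_measurable _ sC.
(* Each term of the maximizing sequence [u] is the integral over some [D i], hence at most the
   integral over the union. *)
have supC : (ereal_sup I <= \int[mu]_(x in \bigcup_i D i) f x)%E.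
  rewrite -(cvg_lim _ ucvg)//; apply: lime_le; first by apply/cvg_ex; exists (ereal_sup I).
  apply: nearW => i; rewrite -(DP i).2; apply: ge0_subset_integral => //.
  - exact: sigma_finite_measurable (DP i).1.
  - exact: measurable_funTS.
  - exact: bigcup_sup.
exists (\bigcup_i D i) => // B sB BC0; have mB := sigma_finite_measurable _ sB.
(* Adjoining [B] cannot push the integral beyond the supremum. Since [B] is disjoint from the union
   and the integral over the union is finite, cancellation leaves a zero integral over [B]. *)
have : (\int[mu]_(x in (\bigcup_i D i) `|` B) f x <= \int[mu]_(x in \bigcup_i D i) f x)%E.
  apply: le_trans supC; apply: ereal_sup_ubound.
  by exists ((\bigcup_i D i) `|` B) => //; exact: sigma_finiteU.
rewrite ge0_integral_setU//; [|exact: measurable_funTS|by apply/disj_set2P; rewrite setIC].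
have Cfin : (\int[mu]_(x in \bigcup_i D i) f x)%E \is a fin_num.
  rewrite ge0_fin_numE ?integral_ge0//.
  by apply: le_lt_trans (ltry c); exact: fc.
rewrite -[X in (_ <= X)%E -> _]adde0 leeD2lE// => B0.
by apply/eqP; rewrite eq_le B0 integral_ge0.
Qed.

(** Integration over [C] becomes integration over the whole space against a sigma-finite measure, as
    Tonelli's theorem requires. The witness is [mu] restricted to [C]: the complement of [C] is null
    for it and can be added to every piece of a cover of [C]. *)
Lemma sigma_finite_restriction C : sigma_finite C mu ->
  exists nu : {sigma_finite_measure set T -> \bar R},
    forall f, (forall x, 0 <= f x)%E -> measurable_fun [set: T] f ->
    (\int[nu]_x f x = \int[mu]_(x in C) f x)%E.
Proof.
move=> sC; have mC := sigma_finite_measurable _ sC.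
have snu : sigma_finite [set: T] (mrestr mu mC).
  have [F CF mF] := sC; exists (fun i => F i `|` ~` C).
    rewrite -(setUv C) [X in X `|` _]CF; apply/seteqP; split => x.
      by move=> [[i _ Fx]|Cx]; [exists i => //; left|exists 0%N => //; right].
    by move=> [i _ [Fx|Cx]]; [left; exists i|right].
  move=> i; have [mFi Fi] := mF i; split; first exact/measurableU/measurableC.
  rewrite /mrestr setIUl setICl setU0; apply: le_lt_trans Fi.
  by apply: le_measure; rewrite ?inE//; exact: measurableI.
pose nu : {sigma_finite_measure set T -> \bar R} :=
  HB.pack (mrestr mu mC) (Measure_isSigmaFinite.Build _ _ _ (mrestr mu mC) snu).
exists nu => f f0 mf; rewrite -(setUv C) ge0_integral_setU//=; last 3 first.
- exact: measurableC.
- exact: measurable_funTS.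
- by apply/disj_set2P; rewrite setICr.
rewrite [X in (_ + X)%E](_ : _ = 0%E) ?adde0.
  apply: eq_measure_integral => A mA AC /=.
  by rewrite /mrestr setIidl.
apply: null_set_integral => //.
- exact: measurableC.
- exact: measurable_funTS.
- by rewrite /= /mrestr setICl measure0.
Qed.

(** Tonelli's theorem for the restrictions of [mu] to [D] and [C]. The measurability of the inner
    integral is recorded because it yields that of the next density. *)
Lemma sigma_finite_tonelli C D (f : T * T -> \bar R) :
  sigma_finite C mu -> sigma_finite D mu -> (forall z, 0 <= f z)%E ->
  measurable_fun [set: T * T] f ->
  measurable_fun [set: T] (fun x => \int[mu]_(y in C) f (x, y))%E /\
  (\int[mu]_(x in D) \int[mu]_(y in C) f (x, y) =
   \int[mu]_(y in C) \int[mu]_(x in D) f (x, y))%E.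
Proof.
move=> /sigma_finite_restriction[nu nuE] /sigma_finite_restriction[mv mvE] f0 mf.
have E1 : (fun x => \int[mu]_(y in C) f (x, y))%E = fubini_F nu f.
  by apply/funext => x; rewrite -nuE//; exact: measurable_fun_pair2.
have E2 : (fun y => \int[mu]_(x in D) f (x, y))%E = fubini_G mv f.
  by apply/funext => x; rewrite -mvE//; exact: measurable_fun_pair1.
split; first by rewrite E1; exact: measurable_fun_fubini_tonelli_F.
rewrite -mvE; last 2 first.
- by move=> x; apply: integral_ge0.
- by rewrite E1; exact: measurable_fun_fubini_tonelli_F.
rewrite -nuE; last 2 first.
- by move=> x; apply: integral_ge0.
- by rewrite E2; exact: measurable_fun_fubini_tonelli_G.
by rewrite E1 E2 /fubini_F /fubini_G fubini_tonelli.
Qed.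

End sigma_finite_sets.

(** * Propagation of subdensities by a kernel, and integral estimates *)

Section transition_kernels.
Context {d : measure_display} {T : measurableType d} {R : realType}.
Variable mu : {measure set T -> \bar R}.
Implicit Types (C D : set T) (f g : T -> \bar R) (h k m : T -> R).

(** The integral is a supremum over simple functions below the integrand, and those below [f] are
    below [g]. This allows comparisons with the truncated functions, which may fail to be
    measurable. *)
Lemma ge0_le_integral_nonmeasurable f g : (forall x, 0 <= f x)%E ->
  (forall x, f x <= g x)%E -> (\int[mu]_x f x <= \int[mu]_x g x)%E.
Proof.
move=> f0 fg; rewrite !ge0_integralTE//; last by move=> x; exact: le_trans (fg x).
apply: ge_ereal_sup => _ [u uf <-]; apply: ereal_sup_ubound.
by exists u => // x; exact: le_trans (fg x).
Qed.

(* For a measure with infinite atoms, [h] may have infinite total integral. *)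
Definition sigma_finite_subdensity h :=
  [/\ forall x, 0 <= h x, measurable_fun [set: T] h &
      forall D, sigma_finite D mu -> (\int[mu]_(x in D) (h x)%:E <= 1)%E].

(* [k] vanishes off a sigma-finite set in its second variable, so [C] captures all
   of the integral and Tonelli's theorem applies on [D * C]. *)
Lemma sigma_finite_subdensity_step (k : T -> T -> R) h :
  measurable_fun [set: T * T] (fun p => k p.1 p.2) ->
  (forall x y, 0 <= k x y) ->
  (forall y, \int[mu]_x (k x y)%:E <= 1)%E ->
  (forall x, \int[mu]_y (k x y)%:E < +oo)%E ->
  sigma_finite_subdensity h ->
  sigma_finite_subdensity (fun x => \int[mu]_y (k x y * h y)).
Proof.
move=> mk k0 k1 koo [h0 mh h1].
have mEh : measurable_fun [set: T] (EFin \o h) by exact/measurable_EFinP.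
have mkr x : measurable_fun [set: T] (k x) by exact: (measurable_fun_pair2 x mk).
have mkl y : measurable_fun [set: T] (k ^~ y) by exact: (measurable_fun_pair1 y mk).
have [C sC hC] : exists2 C, sigma_finite C mu & forall D, sigma_finite D mu ->
    D `&` C = set0 -> (\int[mu]_(x in D) (h x)%:E = 0)%E.
  exact: (sigma_finite_exhaustion mu (EFin \o h) 1).
have mC := sigma_finite_measurable _ _ sC.
pose g (z : T * T) := (k z.1 z.2 * h z.2)%:E.
have g0 z : (0 <= g z)%E by rewrite lee_fin mulr_ge0.
have mg : measurable_fun [set: T * T] g.
  apply/measurable_EFinP/measurable_funM => //.
  by apply: measurableT_comp => //; exact: measurable_snd.
have gC x : (\int[mu]_y g (x, y) = \int[mu]_(y in C) g (x, y))%E.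
  have mgx : measurable_fun [set: T] (fun y => g (x, y)).
    exact: measurable_fun_pair2.
  rewrite -[in LHS](setUv C) ge0_integral_setU//=; last 3 first.
  - exact: measurableC.
  - exact: measurable_funTS.
  - by apply/disj_set2P; rewrite setICr.
  rewrite [X in (_ + X)%E](_ : _ = 0%E) ?adde0//.
  pose S := [set y | 0 < k x y].
  have sS : sigma_finite S mu by exact: sigma_finite_support.
  have sD : sigma_finite (~` C `&` S) mu.
    apply: (sigma_finite_sub _ _ _ sS); last exact: subIsetr.
    apply: measurableI; first exact: measurableC.
    exact: sigma_finite_measurable sS.
  have mD := sigma_finite_measurable _ _ sD.
  transitivity (\int[mu]_(y in ~` C `&` S) g (x, y))%E.
    rewrite integral_mkcondr; apply: eq_integral => y _.
    rewrite /patch; case: ifPn => //; rewrite notin_setE /S/= => /negP.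
    rewrite -leNgt => kle; have kxy0 : k x y = 0 by apply/eqP; rewrite eq_le kle k0.
    by rewrite /g/= kxy0 mul0r.
  (* The set is sigma-finite and disjoint from [C], so [h] has zero integral on it by the choice of
     [C]. *)
  have h_ae0 : ae_eq mu (~` C `&` S) (EFin \o h) (cst 0%E).
    apply/ae_eq_integral_abs => //; first exact: measurable_funTS.
    under eq_integral do rewrite /= ger0_norm//.
    by apply: hC => //; rewrite setIAC setICl set0I.
  rewrite (@ge0_ae_eq_integral _ _ _ mu _ _ (cst 0%E))//.
  - by rewrite integral0.
  - exact: measurable_funTS.
  - apply: filterS h_ae0 => y /= + Dy => /(_ Dy)[hy0].
    by rewrite /g/= hy0 mulr0.
pose G x := (\int[mu]_(y in C) g (x, y))%E.
have G0 x : (0 <= G x)%E by exact: integral_ge0.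
have mG : measurable_fun [set: T] G by have [] := sigma_finite_tonelli _ _ _ _ sC sC g0 mg.
have -> : (fun x => \int[mu]_y (k x y * h y)) = fine \o G.
  by apply/funext => x; rewrite /G/= -gC.
have mfG : measurable_fun [set: T] (fine \o G) by exact: measurableT_comp.
split => // [x|D sD]; first by rewrite fine_ge0.
have mD := sigma_finite_measurable _ _ sD.
(* Where [G] is infinite, [fine] returns 0, so [fine \o G] is below [G] everywhere. *)
apply: (@le_trans _ _ (\int[mu]_(x in D) G x)%E).
  apply: ge0_le_integral => //.
  - by move=> x _; rewrite lee_fin fine_ge0.
  - by apply: measurable_funTS; exact/measurable_EFinP.
  - exact: measurable_funTS.
  - by move=> x _ /=; case: (G x) (G0 x) => //= _; rewrite leey.
have [_ ->] := sigma_finite_tonelli _ _ _ _ sC sD g0 mg.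
apply: le_trans (h1 _ sC); apply: ge0_le_integral => //.
- by move=> y _; apply: integral_ge0.
- apply: measurable_funTS.
  (* Exchanging the coordinates turns the integral in the first variable into the form whose
     measurability Tonelli's theorem provides. *)
  have mg' : measurable_fun [set: T * T] (g \o (fun z => (z.2, z.1))).
    by apply: measurableT_comp => //; exact: measurable_swap.
  have [+ _] := sigma_finite_tonelli _ _ _ _ sD sD (fun z => g0 (z.2, z.1)) mg'.
  exact.
- exact: measurable_funTS.
move=> y _; rewrite /g/=.
under eq_integral do rewrite mulrC EFinM.
rewrite ge0_integralZl_EFin//; last 2 first.
- by move=> x _; rewrite lee_fin.
- by apply: measurable_funTS; exact/measurable_EFinP.
rewrite -[leRHS]mule1 lee_wpmul2l ?lee_fin//; apply: le_trans (k1 y).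
by apply: ge0_subset_integral => //; [exact/measurable_EFinP|move=> x _; rewrite lee_fin].
Qed.

(** The integrand is at most [e * h] on [L] and at most [c * k] off [L]. The sum of both bounds is
    measurable even when [L] is not, and restricting [h] to the sigma-finite set where [k] is
    positive makes its mass at most 1. *)
Lemma integral_subdensity_le k h (L : set T) (e c : R) :
  measurable_fun [set: T] k -> (forall x, 0 <= k x) ->
  (\int[mu]_x (k x)%:E < +oo)%E -> sigma_finite_subdensity h ->
  0 <= e -> 0 <= c ->
  (forall x, L x -> k x <= e) -> (forall x, ~ L x -> h x <= c) ->
  (\int[mu]_x (k x * h x)%:E <= e%:E + c%:E * \int[mu]_x (k x)%:E)%E.
Proof.
move=> mk k0 koo [h0 mh h1] e0 c0 ke hc.
pose S := [set x | 0 < k x].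
have sS : sigma_finite S mu by exact: sigma_finite_support.
have mS := sigma_finite_measurable _ _ sS.
have mEk : measurable_fun [set: T] (EFin \o k) by exact/measurable_EFinP.
have mhS : measurable_fun [set: T] ((EFin \o h) \_ S).
  by apply/(measurable_restrictT _ mS)/measurable_funTS/measurable_EFinP.
have hS0 x : (0 <= ((EFin \o h) \_ S) x)%E.
  by rewrite patchE; case: ifP => //; rewrite lee_fin.
apply: (@le_trans _ _ (\int[mu]_x (e%:E * ((EFin \o h) \_ S) x + c%:E * (k x)%:E))%E).
  apply: ge0_le_integral_nonmeasurable => x; first by rewrite lee_fin mulr_ge0.
  rewrite patchE; case: ifPn => [_|].
    rewrite -!EFinM -EFinD lee_fin; have [Lx|nLx] := pselect (L x).
      by rewrite (le_trans (ler_wpM2r (h0 x) (ke _ Lx)))// lerDl mulr_ge0.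
    by rewrite mulrC (le_trans (ler_wpM2r (k0 x) (hc _ nLx)))// lerDr mulr_ge0.
  rewrite notin_setE /S/= => /negP; rewrite -leNgt => kle.
  have -> : k x = 0 by apply/eqP; rewrite eq_le kle k0.
  by rewrite mul0r !mule0 adde0.
rewrite ge0_integralD//; last first.
- exact: measurable_funeM.
- by move=> x _; rewrite mule_ge0 ?lee_fin.
- exact: measurable_funeM.
- by move=> x _; rewrite mule_ge0 ?lee_fin.
rewrite !ge0_integralZl_EFin//; last by move=> x _; rewrite lee_fin.
rewrite leeD2r// -[leRHS]mule1 lee_wpmul2l// -integral_mkcond.
exact: h1.
Qed.

(* [m] need not be measurable: its integral only occurs as an upper bound for
   that of the positive part of the measurable function [k * (h - c)]. *)
Lemma integral_le_perturb k h m (c : R) :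
  measurable_fun [set: T] k -> measurable_fun [set: T] h ->
  (forall x, 0 <= k x) -> (forall x, 0 <= h x) -> (forall x, 0 <= m x) -> 0 <= c ->
  (forall x, h x <= m x + c) ->
  (\int[mu]_x (k x * h x)%:E <=
   \int[mu]_x (k x * m x)%:E + c%:E * \int[mu]_x (k x)%:E)%E.
Proof.
move=> mk mh k0 h0 m0 c0 hm.
pose p x := Num.max (k x * (h x - c)) 0.
have p0 x : 0 <= p x by rewrite le_max lexx orbT.
have mp : measurable_fun [set: T] (EFin \o p).
  apply/measurable_EFinP/measurable_maxr => //.
  by apply: measurable_funM => //; exact: measurable_funB.
have mEk : measurable_fun [set: T] (EFin \o k) by exact/measurable_EFinP.
apply: (@le_trans _ _ (\int[mu]_x ((p x)%:E + c%:E * (k x)%:E))%E).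
  apply: ge0_le_integral_nonmeasurable => x; first by rewrite lee_fin mulr_ge0.
  rewrite -EFinM -EFinD lee_fin -lerBlDr; apply: le_trans (_ : k x * (h x - c) <= _).
    by rewrite mulrBr [c * _]mulrC.
  by rewrite le_max lexx.
rewrite ge0_integralD//; last first.
- exact: measurable_funeM.
- by move=> x _; rewrite mule_ge0 ?lee_fin.
- by move=> x _; rewrite lee_fin.
rewrite ge0_integralZl_EFin//; last by move=> x _; rewrite lee_fin.
apply: leeD2r.
apply: ge0_le_integral_nonmeasurable => x; first by rewrite lee_fin.
by rewrite lee_fin ge_max mulr_ge0// andbT ler_wpM2l// lerBlDr.
Qed.

End transition_kernels.

(** * Error bounds for the truncated densities, by induction on time *)

Theorem theorem3p3 (R : realType) (S : pmetricType R)
    (mu : {measure set (borel S) -> \bar R})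
    (t : S -> S -> R) (p0 : S -> R)
    (Gam : set (S * S)) (L0 : set S) (eps eps0 : R) (N : nat)
    (sepS : separable S)
    (ht : transition_density mu t)
    (hp0 : probability_density mu p0)
    (hMf : (Mf mu t < +oo)%E)
    (eps_gt0 : 0 < eps) (eps0_gt0 : 0 < eps0)
    (hGam : forall s s', ~ Gam (s, s') -> t s' s <= eps)
    (hL0 : forall s, ~ L0 s -> p0 s <= eps0) :
  forall n, (n <= N)%N ->
    (ereal_sup [set `|density_at mu t p0 n s
                      - truncated_at mu t p0 Gam L0 N n s|%:E | s in [set: S]]
     <= (error_bound mu t eps eps0 n)%:E)%E.
Proof.
case: ht => t0 mt t1; case: hp0 => p00 mp0 p01.
pose M := fine (Mf mu t).
have tM s' : (\int[mu]_s (t s' s)%:E <= Mf mu t)%E.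
  by apply: ereal_sup_ubound; exists s'.
(* A supremum over a nonempty set of nonnegative integrals; [point] supplies a member. *)
have Mf0 : (0 <= Mf mu t)%E.
  by apply: le_trans (tM point); apply: integral_ge0 => s _; rewrite lee_fin.
have MfE : Mf mu t = M%:E by rewrite fineK// ge0_fin_numE.
have M0 : 0 <= M by exact: fine_ge0.
have tfin s' : (\int[mu]_s (t s' s)%:E < +oo)%E by exact: le_lt_trans hMf.
have mtr s' : measurable_fun [set: borel S] (t s').
  exact: (measurable_fun_pair2 (s' : borel S) mt).
have err0 n : 0 <= error_bound mu t eps eps0 n.
  by elim: n => [|n IH] /=; [exact: ltW|rewrite addr_ge0 ?mulr_ge0// ltW].
have subd n : sigma_finite_subdensity mu (density_at mu t p0 n : borel S -> R).
  elim: n => [|n IH] /=.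
    split=> // D sD; rewrite -p01; apply: ge0_subset_integral => //.
    - exact: sigma_finite_measurable sD.
    - exact/measurable_EFinP.
    - by move=> s _; rewrite lee_fin.
  by apply: sigma_finite_subdensity_step => // s; rewrite t1.
(* Passing to real values is harmless: if [a] is infinite then so is [b], and both become 0. *)
have err_le (a b : \bar R) : (0 <= b)%E -> (b <= a)%E -> forall e, 0 <= e ->
    (a <= b + e%:E)%E -> 0 <= fine a - fine b <= e.
  case: a b => [a| |] [b| |]//=; rewrite ?subr0 ?lexx// => b0 ba e e0.
  by rewrite -EFinD !lee_fin in ba b0 * => abe; rewrite subr_ge0 ba lerBlDl.
have off n : forall s, ~ support_at Gam L0 n s ->
    density_at mu t p0 n s <= error_bound mu t eps eps0 n.
  elim: n => [//|n IH] s' nL /=.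
  have [h0 mh h1] := subd n.
  (* A transition in [Gam] from a point of [Lambda_n] would put [s'] into [Lambda_(n+1)]. *)
  have teps s : support_at Gam L0 n s -> t s' s <= eps.
    by move=> Ls; apply: hGam => Gs; apply: nL; exists s.
  have le1 := integral_subdensity_le mu (t s') _ _ eps _ (mtr s') (t0 s')
    (tfin s') (subd n) (ltW eps_gt0) (err0 n) teps IH.
  have le2 : (\int[mu]_s (t s' s * density_at mu t p0 n s)%:E <=
      (eps + M * error_bound mu t eps eps0 n)%:E)%E.
    apply: le_trans le1 _; rewrite EFinD leeD2l// mulrC EFinM lee_wpmul2l ?lee_fin//.
    by rewrite -MfE.
  rewrite -lee_fin fineK// ge0_fin_numE ?(le_lt_trans le2) ?ltry//.
  by apply: integral_ge0 => s _; rewrite lee_fin mulr_ge0.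
(* The induction also carries [0 <= mu_n <= pi_n]: nonnegativity is needed to compare the integrals,
   domination to apply [err_le]. *)
have trunc n : (n <= N)%N -> forall s, 0 <= truncated_at mu t p0 Gam L0 N n s /\
    0 <= density_at mu t p0 n s - truncated_at mu t p0 Gam L0 N n s
      <= error_bound mu t eps eps0 n.
  elim: n => [_ s|n IH nN s'].
    rewrite /= indicE; have [Ls|nLs] := pselect (L0 s).
      by rewrite mem_set// mul1r subrr lexx (ltW eps0_gt0); split.
    by rewrite memNset// mul0r subr0 p00 hL0.
  have [h0 mh _] := subd n; have {}IH := IH (ltnW nN).
  have m0 s := (IH s).1.
  rewrite /= indicE; have [Us|nUs] := pselect (support_upto Gam L0 N s'); last first.
    (* Off [Upsilon] the error is [pi_(n+1)] itself. As [n+1 <= N], the point is outside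
       [Lambda_(n+1)] and [off] applies. *)
    rewrite memNset// mul0r subr0 lexx; split => //; apply/andP; split.
      by have [+ _ _] := subd n.+1; exact.
    by apply: (off n.+1) => Ls; apply: nUs; exists n.+1.
  rewrite mem_set// mul1r.
  have I0 : (0 <= \int[mu]_s (t s' s * truncated_at mu t p0 Gam L0 N n s)%:E)%E.
    by apply: integral_ge0 => s _; rewrite lee_fin mulr_ge0.
  split; first exact: fine_ge0.
  apply: err_le => //.
  - apply: ge0_le_integral_nonmeasurable => s; first by rewrite lee_fin mulr_ge0.
    by rewrite lee_fin ler_wpM2l// -subr_ge0; have [_ /andP[]] := IH s.
  - exact: (err0 n.+1).
  apply: le_trans (@integral_le_perturb _ _ _ mu (t s') _
    (truncated_at mu t p0 Gam L0 N n) (error_bound mu t eps eps0 n) _ mh _ h0 m0 (err0 n) _) _ => //.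
    by move=> s; rewrite -lerBlDl; have [_ /andP[]] := IH s.
  (* On [Upsilon] the error is at most [M * err_n]; the summand [eps] is slack here. *)
  rewrite leeD2l//= (@le_trans _ _ (M * error_bound mu t eps eps0 n)%:E)//.
    by rewrite mulrC EFinM lee_wpmul2l ?lee_fin// -MfE.
  by rewrite lee_fin lerDr ltW.
move=> n nN; apply: ge_ereal_sup => _ [s _ <-].
by have [_ /andP[d0 dle]] := trunc n nN s; rewrite ger0_norm// lee_fin.
Qed.
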